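(* Let $\mathbf{T}\equiv(T_1,T_2)$ be a subnormal $2$-variable weighted shift with weights $\alpha_{(i,j)},\beta_{(i,j)}>0$, and for $i,j\ge 1$ let $W_{\alpha^{(j)}}:=\mathrm{shift}(\alpha_{(0,j)},\alpha_{(1,j)},\dots)$ be the $j$-th horizontal slice and $W_{\beta^{(i)}}:=\mathrm{shift}(\beta_{(i,0)},\beta_{(i,1)},\dots)$ the $i$-th vertical slice of $\mathbf{T}$. Then $\|W_{\alpha^{(j)}}\|=\|W_{\alpha^{(1)}}\|$ for all $j\ge 1$ and $\|W_{\beta^{(i)}}\|=\|W_{\beta^{(1)}}\|$ for all $i\ge 1$.
   Context: A $2$-variable weighted shift with bounded positive weights $\alpha_{(i,j)},\beta_{(i,j)}$ ($(i,j)\in\mathbb{Z}_+^2$) is the pair $\mathbf{T}\equiv(T_1,T_2)$ of bounded operators on $\ell^2(\mathbb{Z}_+^2)$, with canonical orthonormal basis $\{e_{(i,j)}\}$, given by $T_1e_{(i,j)}=\alpha_{(i,j)}e_{(i+1,j)}$ and $T_2e_{(i,j)}=\beta_{(i,j)}e_{(i,j+1)}$, and assumed commuting, i.e. $\beta_{(i+1,j)}\alpha_{(i,j)}=\alpha_{(i,j+1)}\beta_{(i,j)}$ for all $i,j$. The pair is subnormal if there are a Hilbert space $\mathcal{K}\supseteq\ell^2(\mathbb{Z}_+^2)$ and commuting normal operators $N_1,N_2$ on $\mathcal{K}$ leaving $\ell^2(\mathbb{Z}_+^2)$ invariant with $N_i|_{\ell^2(\mathbb{Z}_+^2)}=T_i$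 $(i=1,2)$. $\mathrm{shift}(w_0,w_1,\dots)$ denotes the unilateral weighted shift $e_n\mapsto w_ne_{n+1}$ on $\ell^2(\mathbb{Z}_+)$. *)

(* Defs.v *)
From HB Require Import structures.
From mathcomp Require Import all_boot all_order all_algebra sesquilinear.
From mathcomp Require Import complex finmap.
From mathcomp Require Import all_classical all_reals.
From mathcomp Require Import ereal topology normedtype sequences esum.
From mathcomp Require Import ring lra.

Set Implicit Arguments.
Unset Strict Implicit.
Unset Printing Implicit Defensive.
Import Order.TTheory GRing.Theory Num.Theory.
Import numFieldNormedType.Exports.

Local Open Scope classical_set_scope.
Local Open Scope ring_scope.
Local Open Scope complex_scope.

Definition dot_norm (R : realType) (H : lmodType R[i])
    (d : {dot H for @Num.conj R[i]}) (x : H) : R :=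
  Num.sqrt (complex.Re (d x x)).

(* The inner product is linear in its first argument and conjugate-linear in
   its second one. *)
Record hilbertSpace (R : realType) := HilbertSpace {
  hcarrier :> lmodType R[i];
  inner : {dot hcarrier for @Num.conj R[i]};
  hcomplete : forall u : nat -> hcarrier,
    (forall e : R, 0 < e -> exists N : nat, forall m n : nat,
       (N <= m)%N -> (N <= n)%N -> dot_norm inner (u m - u n) < e) ->
    exists l : hcarrier, forall e : R, 0 < e -> exists N : nat, forall n : nat,
       (N <= n)%N -> dot_norm inner (u n - l) < e
}.

Definition hnorm (R : realType) (H : hilbertSpace R) (x : H) : R :=
  dot_norm (@inner R H) x.

Section operators.
Context {R : realType}.
Implicit Types H K : hilbertSpace R.

Definition bounded_op H K (A : {linear H -> K}) : Prop :=
  exists M : R, forall x : H, hnorm (A x) <= M * hnorm x.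

Definition opnorm H K (A : {linear H -> K}) : R :=
  sup [set hnorm (A x) | x in [set x : H | hnorm x <= 1]].

Definition is_adjoint H (A B : {linear H -> H}) : Prop :=
  forall x y : H, inner H (A x) y = inner H x (B y).

Definition normal_op H (A : {linear H -> H}) : Prop :=
  bounded_op A /\
  exists B : {linear H -> H}, is_adjoint A B /\ forall x : H, A (B x) = B (A x).

(* The inclusion of H in K is an inner-product preserving linear map iota; the
   equations N_i (iota x) = iota (T_i x) say both that the image of H is
   invariant under N_i and that N_i restricts to T_i there. *)
Definition subnormal_pair H (T1 T2 : {linear H -> H}) : Prop :=
  exists (K : hilbertSpace R) (iota : {linear H -> K}) (N1 N2 : {linear K -> K}),
    [/\ forall x y : H, inner K (iota x) (iota y) = inner H x y,
        normal_op N1 /\ normal_op N2,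
        forall z : K, N1 (N2 z) = N2 (N1 z),
        forall x : H, N1 (iota x) = iota (T1 x) &
        forall x : H, N2 (iota x) = iota (T2 x)].

End operators.

Section sums.
Context {R : realType} {I : choiceType}.
Implicit Types (f g : I -> R) (z : I -> R[i]).

Definition nsum f : \bar R := (\esum_(i in [set: I]) (f i)%:E)%E.

(* Sum of a real family as the sum of its positive part minus that of its
   negative part; meaningful for absolutely summable families, the only ones
   it is applied to (lemma l2_dot_summable). *)
Definition rsum f : R :=
  fine (nsum (fun i => Num.max (f i) 0)) -
  fine (nsum (fun i => Num.max (- f i) 0)).

Definition csum z : R[i] :=
  rsum (fun i => complex.Re (z i)) +i* rsum (fun i => complex.Im (z i)).

Definition sqmod (z : R[i]) : R := complex.Re z ^+ 2 + complex.Im z ^+ 2.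

Lemma nsum_ge0 f : (forall i, 0 <= f i) -> (0 <= nsum f)%E.
Proof. by move=> f0; apply: esum_ge0 => i _; rewrite lee_fin. Qed.

Lemma le_nsum f g : (forall i, f i <= g i) -> (nsum f <= nsum g)%E.
Proof. by move=> fg; apply: le_esum => i _; rewrite lee_fin. Qed.

Lemma eq_nsum f g : f =1 g -> nsum f = nsum g.
Proof. by move=> fg; apply: eq_esum => i _; rewrite fg. Qed.

Lemma nsumD f g : (forall i, 0 <= f i) -> (forall i, 0 <= g i) ->
  nsum (fun i => f i + g i) = (nsum f + nsum g)%E.
Proof.
move=> f0 g0; rewrite /nsum -esumD //; last 2 first.
- by move=> i _; rewrite lee_fin.
- by move=> i _; rewrite lee_fin.
Qed.

Lemma nsum_fin f g : (forall i, 0 <= f i) -> (forall i, f i <= g i) ->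
  (nsum g < +oo)%E -> nsum f \is a fin_num.
Proof.
move=> f0 fg goo; rewrite ge0_fin_numE ?nsum_ge0 //.
exact: le_lt_trans (le_nsum fg) goo.
Qed.

Lemma nsum_ub f (M : R) : (forall F : {fset I}, \sum_(i <- F) f i <= M) ->
  (nsum f <= M%:E)%E.
Proof.
move=> fM; apply: ge_ereal_sup => _ [F [finF _] <-].
by rewrite fsbig_finite //= sumEFin lee_fin.
Qed.

Lemma nsum_lb f (F : {fset I}) : (forall i, 0 <= f i) ->
  ((\sum_(i <- F) f i)%:E <= nsum f)%E.
Proof.
move=> f0; apply: esum_ge; exists [set` F]; first by split.
by rewrite fsbig_finite //= set_fsetK sumEFin.
Qed.

Lemma nsum_term f i : (forall j, 0 <= f j) -> ((f i)%:E <= nsum f)%E.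
Proof.
by move=> f0; apply: le_trans (nsum_lb [fset i]%fset f0); rewrite big_seq_fset1.
Qed.

Lemma nsumZ f (c : R) : (forall i, 0 <= f i) -> 0 <= c ->
  (nsum f < +oo)%E -> nsum (fun i => c * f i) = (c%:E * nsum f)%E.
Proof.
move=> f0 c0 foo.
have ff : nsum f \is a fin_num by rewrite ge0_fin_numE ?nsum_ge0.
have key : forall (g : I -> R) (d : R), (forall i, 0 <= g i) -> 0 <= d ->
    nsum g \is a fin_num -> (nsum (fun i => (d * g i)%R) <= d%:E * nsum g)%E.
  move=> g d g0 d0 gf; rewrite -(fineK gf) -EFinM; apply: nsum_ub => F.
  rewrite -mulr_sumr ler_wpM2l // -lee_fin fineK //; exact: nsum_lb.
apply/eqP; rewrite eq_le key //=.
have [->|c1] := eqVneq c 0; first by rewrite mul0e nsum_ge0 // => i; rewrite mul0r.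
have cf : nsum (fun i => c * f i) \is a fin_num.
  rewrite ge0_fin_numE ?nsum_ge0 // => [|i]; last exact: mulr_ge0.
  by rewrite (le_lt_trans (key _ _ f0 c0 ff)) // -(fineK ff) -EFinM ltry.
have := key (fun i => c * f i) c^-1.
move=> /(_ (fun i => mulr_ge0 c0 (f0 i))).
rewrite invr_ge0 => /(_ c0 cf).
rewrite (@eq_nsum _ f) => [|i]; last by rewrite mulKf.
have cp : 0 < c by rewrite lt_def c1.
rewrite -(fineK cf) -(fineK ff) -!EFinM !lee_fin => h.
by rewrite mulrC -ler_pdivlMr // mulrC.
Qed.

Definition rsummable f := (nsum (fun i => `|f i|%R) < +oo)%E.

Lemma rsum_sub f g h : (forall i, 0 <= g i) -> (forall i, 0 <= h i) ->
  (nsum g < +oo)%E -> (nsum h < +oo)%E -> (forall i, f i = g i - h i) ->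
  rsum f = fine (nsum g) - fine (nsum h).
Proof.
move=> g0 h0 goo hoo fE.
have p0 i : 0 <= Num.max (f i) 0 by rewrite le_max lexx orbT.
have n0 i : 0 <= Num.max (- f i) 0 by rewrite le_max lexx orbT.
have pg i : Num.max (f i) 0 <= g i.
  by rewrite ge_max g0 andbT fE; have := h0 i; lra.
have nh i : Num.max (- f i) 0 <= h i.
  by rewrite ge_max h0 andbT fE; have := g0 i; lra.
have pf := nsum_fin p0 pg goo.
have nf := nsum_fin n0 nh hoo.
have gf := nsum_fin g0 (fun i => lexx _) goo.
have hf := nsum_fin h0 (fun i => lexx _) hoo.
have := nsumD p0 h0; rewrite (@eq_nsum _ (fun i => Num.max (- f i) 0 + g i)).
  rewrite nsumD // => /(congr1 fine); rewrite !fineD // /rsum => e.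
  by apply/eqP; rewrite subr_eq addrAC eq_sym subr_eq -e addrC.
move=> i; rewrite fE; have [h1|h1] := leP (g i - h i) 0.
  by rewrite max_l; lra.
by rewrite max_r; lra.
Qed.

Lemma rsummable_part f : rsummable f ->
  (nsum (fun i => Num.max (f i) 0%R) < +oo)%E /\
  (nsum (fun i => Num.max (- f i)%R 0%R) < +oo)%E.
Proof.
move=> fs; split; apply: le_lt_trans fs; apply: le_nsum => i;
  rewrite ge_max normr_ge0 andbT; first exact: ler_norm.
by rewrite -normrN ler_norm.
Qed.

Lemma rsummable_le f g : (forall i, `|f i| <= g i) -> (nsum g < +oo)%E ->
  rsummable f.
Proof. by move=> fg; apply: le_lt_trans; apply: le_nsum. Qed.

Lemma rsum_ge0E f : (forall i, 0 <= f i) -> rsum f = fine (nsum f).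
Proof.
move=> f0; rewrite /rsum [X in _ - fine X](_ : _ = 0%E); last first.
  rewrite /nsum esum1 // => i _; rewrite max_r // oppr_le0 //.
by rewrite subr0; congr fine; apply: eq_nsum => i; rewrite max_l.
Qed.

Lemma eq_rsum f g : f =1 g -> rsum f = rsum g.
Proof. by move=> /funext ->. Qed.

Lemma rsummableD f g : rsummable f -> rsummable g ->
  rsummable (fun i => f i + g i).
Proof.
move=> fs gs; apply: (@rsummable_le _ (fun i => `|f i| + `|g i|)) => [i|].
  exact: ler_normD.
by rewrite nsumD //; exact: lte_add_pinfty.
Qed.

Lemma rsummableN f : rsummable f -> rsummable (fun i => - f i).
Proof. by rewrite /rsummable; under [in X in _ -> X]eq_nsum do rewrite normrN. Qed.

Lemma rsummableZ f c : rsummable f -> rsummable (fun i => c * f i).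
Proof.
move=> fs; rewrite /rsummable (@eq_nsum _ (fun i => `|c| * `|f i|)).
  rewrite nsumZ //.
  have ff : nsum (fun i => `|f i|) \is a fin_num by rewrite ge0_fin_numE ?nsum_ge0.
  by rewrite -(fineK ff) -EFinM ltry.
by move=> i; rewrite normrM.
Qed.

Lemma rsumD f g : rsummable f -> rsummable g ->
  rsum (fun i => f i + g i) = rsum f + rsum g.
Proof.
move=> /rsummable_part[fp fn] /rsummable_part[gp gn].
have mx0 (x : R) : 0 <= Num.max x 0 by rewrite le_max lexx orbT.
rewrite (@rsum_sub _ (fun i => Num.max (f i) 0 + Num.max (g i) 0)
                     (fun i => Num.max (- f i) 0 + Num.max (- g i) 0)).
- rewrite !nsumD // !fineD ?ge0_fin_numE ?nsum_ge0 // /rsum.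
  by rewrite opprD addrACA.
- by move=> i; rewrite addr_ge0.
- by move=> i; rewrite addr_ge0.
- by rewrite nsumD //; exact: lte_add_pinfty.
- by rewrite nsumD //; exact: lte_add_pinfty.
- have mxB (x : R) : x = Num.max x 0 - Num.max (- x) 0.
    by have [h|h] := leP x 0; [rewrite max_l|rewrite max_r]; lra.
  by move=> i; rewrite {1}(mxB (f i)) {1}(mxB (g i)) opprD addrACA.
Qed.

Lemma rsumN f : rsum (fun i => - f i) = - rsum f.
Proof.
rewrite /rsum opprB; congr (_ - fine _); apply: eq_nsum => i.
by rewrite opprK.
Qed.

Lemma rsumZ f c : rsummable f -> rsum (fun i => c * f i) = c * rsum f.
Proof.
wlog c0 : c / 0 <= c => [hw fs|fs].
  have [c0|c0] := leP 0 c; first exact: hw.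
  rewrite -[c]opprK mulNr -hw ?oppr_ge0 ?ltW // -rsumN.
  by apply: eq_rsum => i; rewrite mulNr.
have [fp fn] := rsummable_part fs.
have mx0 (x : R) : 0 <= Num.max x 0 by rewrite le_max lexx orbT.
rewrite /rsum mulrBr; congr (_ - _).
  rewrite -[c * _]/(fine c%:E * _) -fineM ?ge0_fin_numE ?nsum_ge0 ?ltry //.
  rewrite -nsumZ //; congr fine; apply: eq_nsum => i.
  by rewrite maxr_pMr // mulr0.
rewrite -[c * _]/(fine c%:E * _) -fineM ?ge0_fin_numE ?nsum_ge0 ?ltry //.
rewrite -nsumZ //; congr fine; apply: eq_nsum => i.
by rewrite maxr_pMr // mulr0 mulrN.
Qed.

End sums.

Section l2.
Context {R : realType} {I : choiceType}.
Implicit Types (x y : I -> R[i]).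

Definition l2_pred : {pred I -> R[i]} :=
  fun x => (nsum (fun i => sqmod (x i)) < +oo)%E.

Lemma sqmod_ge0 (z : R[i]) : 0 <= sqmod z.
Proof. by rewrite addr_ge0 ?sqr_ge0. Qed.
Hint Resolve sqmod_ge0 : core.

Lemma sqmodD_le (z w : R[i]) : sqmod (z + w) <= 2 * sqmod z + 2 * sqmod w.
Proof.
case: z w => [a b] [c d]; rewrite /sqmod /=.
by have := sqr_ge0 (a - c); have := sqr_ge0 (b - d); nra.
Qed.

Lemma sqmodM (z w : R[i]) : sqmod (z * w) = sqmod z * sqmod w.
Proof. by case: z w => [a b] [c d]; rewrite /sqmod /=; ring. Qed.

Lemma l2_pred_le x (g : I -> R) : (forall i, sqmod (x i) <= g i) ->
  (nsum g < +oo)%E -> x \in l2_pred.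
Proof. by move=> xg goo; rewrite unfold_in; apply: le_lt_trans goo; apply: le_nsum. Qed.

Lemma nsumZ_lt (f : I -> R) c : 0 <= c -> (forall i, 0 <= f i) ->
  (nsum f < +oo)%E -> (nsum (fun i => (c * f i)%R) < +oo)%E.
Proof.
move=> c0 f0 foo; rewrite nsumZ //.
have ff : nsum f \is a fin_num by rewrite ge0_fin_numE ?nsum_ge0.
by rewrite -(fineK ff) -EFinM ltry.
Qed.

Lemma l2_submod_closed : submod_closed l2_pred.
Proof.
split=> [|a x y].
  rewrite unfold_in /nsum esum1 ?ltry // => i _.
  by rewrite /sqmod /= !expr0n addr0.
rewrite !unfold_in => xs ys.
apply: (@l2_pred_le _ (fun i => 2 * (sqmod a * sqmod (x i)) + 2 * sqmod (y i))).
  by move=> i; rewrite (le_trans (sqmodD_le _ _)) // sqmodM.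
rewrite nsumD => [|i|i]; rewrite ?mulr_ge0 //.
by apply: lte_add_pinfty; do !apply: nsumZ_lt => // *; rewrite ?mulr_ge0.
Qed.

HB.instance Definition _ :=
  GRing.isSubmodClosed.Build R[i] (I -> R[i]) l2_pred l2_submod_closed.

Record l2 : Type := L2 { l2_fun :> I -> R[i]; _ : l2_fun \in l2_pred }.

HB.instance Definition _ := [isSub for l2_fun].
HB.instance Definition _ := [Choice of l2 by <:].
HB.instance Definition _ := [SubChoice_isSubLmodule of l2 by <:].

Lemma l2P (u : l2) : (nsum (fun i => sqmod (u i)) < +oo)%E.
Proof. exact: (valP u). Qed.

Definition l2_dot (u v : l2) : R[i] := csum (fun i => u i * (v i)^*).

Lemma l2_dot_summable (u v : l2) :
  rsummable (fun i => complex.Re (u i * (v i)^*)) /\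
  rsummable (fun i => complex.Im (u i * (v i)^*)).
Proof.
have s : (nsum (fun i => (sqmod (u i) + sqmod (v i))%R) < +oo)%E.
  by rewrite nsumD //; apply: lte_add_pinfty; exact: l2P.
by split; apply: rsummable_le s => i; case: (u i) (v i) => [a b] [c d];
  rewrite /sqmod /= ler_norml; apply/andP;
  have := sqr_ge0 (a - c); have := sqr_ge0 (b - d);
  have := sqr_ge0 (a + c); have := sqr_ge0 (b + d);
  have := sqr_ge0 (a - d); have := sqr_ge0 (b - c);
  have := sqr_ge0 (a + d); have := sqr_ge0 (b + c); split; nra.
Qed.

Lemma rsum_lin3 (p q : R) (f g h : I -> R) :
  rsummable f -> rsummable g -> rsummable h ->
  rsum (fun i => p * f i + q * g i + h i) = p * rsum f + q * rsum g + rsum h.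
Proof.
move=> fs gs hs; have pf := rsummableZ p fs; have qg := rsummableZ q gs.
rewrite (rsumD (rsummableD pf qg) hs) (rsumD pf qg).
by rewrite (rsumZ p fs) (rsumZ q gs).
Qed.

Lemma l2_dotC (u v : l2) : l2_dot u v = (-1) ^+ false * (l2_dot v u)^*%R.
Proof.
rewrite expr0 mul1r /l2_dot /csum -[RHS]/(_ -i* _) -rsumN.
by congr (_ +i* _); apply: eq_rsum => i; case: (u i) (v i) => [a b] [c d] /=; ring.
Qed.

Lemma l2_dot_linear (v : l2) : GRing.linear_for *%R (l2_dot^~ v).
Proof.
move=> a u w.
have [uR uI] := l2_dot_summable u v; have [wR wI] := l2_dot_summable w v.
have lE i : (a *: u + w : l2) i = a * u i + w i by [].
rewrite /l2_dot /csum; case: a lE => p q lE.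
rewrite -[RHS]/(_ +i* _); congr (_ +i* _).
  rewrite -mulNr -rsum_lin3 //; apply: eq_rsum => i.
  rewrite lE.
  by case: (u i) (w i) (v i) => [a b] [c d] [e f] /=; ring.
rewrite -rsum_lin3 //; apply: eq_rsum => i.
rewrite lE.
by case: (u i) (w i) (v i) => [a b] [c d] [e f] /=; ring.
Qed.

Lemma l2_dot_bilinear :
  bilinear_for (GRing.Scale.Law.clone _ _ *%R _)
    (GRing.Scale.Law.clone _ _ (@Num.conj R[i] \; *%R) _) l2_dot.
Proof.
split=> [v|u a v w]; first exact: l2_dot_linear.
rewrite /= !(l2_dotC u) !expr0 !mul1r l2_dot_linear.
by rewrite rmorphD rmorphM.
Qed.

HB.instance Definition _ :=
  bilinear_isBilinear.Build R[i] l2 l2 R[i] _ _ l2_dot l2_dot_bilinear.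
HB.instance Definition _ :=
  isHermitianSesquilinear.Build R[i] l2 false (@Num.conj R[i]) l2_dot l2_dotC.

Lemma l2_dotE (u : l2) : l2_dot u u = (fine (nsum (fun i => sqmod (u i))))%:C.
Proof.
rewrite /l2_dot /csum -rsum_ge0E //; congr (_ +i* _).
  by apply: eq_rsum => i; case: (u i) => a b; rewrite /sqmod /=; ring.
rewrite (@eq_rsum _ _ _ (fun=> 0)).
  by rewrite rsum_ge0E // /nsum esum1.
by move=> i; case: (u i) => a b /=; ring.
Qed.

Lemma l2_term (u : l2) i : sqmod (u i) <= fine (nsum (fun i => sqmod (u i))).
Proof.
rewrite -lee_fin fineK; first exact: (@nsum_term _ _ (fun i => sqmod (u i))).
by rewrite ge0_fin_numE ?nsum_ge0 //; exact: l2P.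
Qed.

Lemma l2_dot_gt0 (u : l2) : u != 0 -> 0 < l2_dot u u.
Proof.
move=> u0; rewrite l2_dotE ltcR lt_def fine_ge0 ?nsum_ge0 // andbT.
apply: contra u0 => /eqP e; apply/eqP/val_inj/funext => i /=.
have := l2_term u i; rewrite e /sqmod => h.
have ha := sqr_ge0 (complex.Re (u i)); have hb := sqr_ge0 (complex.Im (u i)).
have /eqP ea : complex.Re (u i) ^+ 2 == 0 by rewrite eq_le; apply/andP; split; lra.
have /eqP eb : complex.Im (u i) ^+ 2 == 0 by rewrite eq_le; apply/andP; split; lra.
move/eqP: ea eb; rewrite sqrf_eq0 => /eqP ea /eqP; rewrite sqrf_eq0 => /eqP eb.
by rewrite [LHS]complexE -[u i in X in complex.Re X]/(u i) ea eb mulr0 addr0.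
Qed.

HB.instance Definition _ := isDotProduct.Build R[i] l2 l2_dot l2_dot_gt0.


Lemma l2_normE (u : l2) :
  dot_norm l2_dot u = Num.sqrt (fine (nsum (fun i => sqmod (u i)))).
Proof. by rewrite -[LHS]/(Num.sqrt (complex.Re (l2_dot u u))) l2_dotE. Qed.

Lemma l2_norm_lt (u : l2) (e : R) : 0 < e ->
  (dot_norm l2_dot u < e) = (fine (nsum (fun i => sqmod (u i))) < e ^+ 2).
Proof.
move=> e0; rewrite l2_normE.
by rewrite -{1}[e]ger0_norm ?ltW // -sqrtr_sqr ltr_sqrt // exprn_gt0.
Qed.

Lemma cvg_cauchy_real (s : nat -> R) :
  (forall e : R, 0 < e -> exists N : nat, forall m n : nat,
     (N <= m)%N -> (N <= n)%N -> (s m - s n) ^+ 2 < e ^+ 2) ->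
  exists a : R, s @ \oo --> (a : R).
Proof.
move=> cs; suff /cvg_ex[a sa] : cvg (s @ \oo) by exists a.
apply/cauchy_cvgP/cauchy_ballP => e e0; near_simpl.
have [N NP] := cs _ e0.
exists ([set n | (N <= n)%N], [set n | (N <= n)%N]); first by split; exists N.
case=> m n [/= mN nN]; rewrite -ball_normE /=.
have := NP m n mN nN; rewrite -[X in X < _ -> _]real_normK ?num_real // => h.
by move: h; rewrite ltr_pXn2r ?nnegrE ?(ltW e0).
Qed.

Lemma l2_complete (u : nat -> l2) :
  (forall e : R, 0 < e -> exists N : nat, forall m n : nat,
     (N <= m)%N -> (N <= n)%N -> dot_norm l2_dot (u m - u n) < e) ->
  exists l : l2, forall e : R, 0 < e -> exists N : nat, forall n : nat,
     (N <= n)%N -> dot_norm l2_dot (u n - l) < e.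
Proof.
move=> cu.
have uE m n i : (u m - u n : l2) i = u m i - u n i by [].
have cr i : exists a : R, (fun n => complex.Re (u n i)) @ \oo --> a.
  apply: cvg_cauchy_real => e e0; have [N NP] := cu _ e0; exists N => m n mN nN.
  have := NP m n mN nN; rewrite l2_norm_lt //; apply: le_lt_trans.
  apply: le_trans (l2_term _ i); rewrite uE /sqmod.
  case: (u m i) (u n i) => [a b] [c d] /=.
  by rewrite lerDl sqr_ge0.
have ci i : exists a : R, (fun n => complex.Im (u n i)) @ \oo --> a.
  apply: cvg_cauchy_real => e e0; have [N NP] := cu _ e0; exists N => m n mN nN.
  have := NP m n mN nN; rewrite l2_norm_lt //; apply: le_lt_trans.
  apply: le_trans (l2_term _ i); rewrite uE /sqmod.
  case: (u m i) (u n i) => [a b] [c d] /=.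
  by rewrite lerDr sqr_ge0.
have [lr lrP] := choice cr; have [li liP] := choice ci.
pose l i : R[i] := lr i +i* li i.
have key (e : R) : 0 < e -> exists N : nat, forall n, (N <= n)%N ->
    (nsum (fun i => sqmod (u n i - l i)%R) <= (e ^+ 2)%:E)%E.
  move=> e0; have [N NP] := cu _ e0; exists N => n nN.
  apply: nsum_ub => F.
  have cvF : (fun m => \sum_(i <- F) sqmod (u n i - u m i)) @ \oo -->
             \sum_(i <- F) sqmod (u n i - l i).
    elim: (enum_fset F) => [|i s IH].
      rewrite big_nil; under eq_fun do rewrite big_nil; exact: cvg_cst.
    rewrite big_cons; under eq_fun do rewrite big_cons.
    apply: cvgD => //; rewrite /sqmod /l.
    case: (u n i) => a b.
    have -> : (fun m => complex.Re ((a +i* b) - u m i) ^+ 2 +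
                        complex.Im ((a +i* b) - u m i) ^+ 2) =
              (fun m => (a - complex.Re (u m i)) * (a - complex.Re (u m i)) +
                        (b - complex.Im (u m i)) * (b - complex.Im (u m i))).
      by apply/funext => m; case: (u m i).
    rewrite /= !expr2.
    by apply: cvgD; apply: cvgM; apply: cvgB; try exact: cvg_cst;
      [exact: lrP|exact: lrP|exact: liP|exact: liP].
  apply: (cvgr_to_le cvF); exists N => // m /= mN.
  have := NP n m nN mN; rewrite l2_norm_lt // => /ltW; apply: le_trans.
  rewrite -lee_fin fineK; last by rewrite ge0_fin_numE ?nsum_ge0 //; exact: l2P.
  exact: (@nsum_lb _ _ (fun i => sqmod ((u n - u m : l2) i))).
have dl n (e : R) : (nsum (fun i => sqmod (u n i - l i)%R) <= (e ^+ 2)%:E)%E ->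
    (u n : I -> R[i]) - l \in l2_pred.
  by move=> h; rewrite unfold_in; apply: le_lt_trans h _; rewrite ltry.
have [N0 /(_ N0 (leqnn _)) /dl lN0] := key 1 ltr01.
have ll : l \in l2_pred.
  have -> : l = (u N0 : I -> R[i]) - ((u N0 : I -> R[i]) - l).
    by rewrite opprB addrC subrK.
  by rewrite rpredB //; exact: valP.
exists (L2 ll) => e e0; have e20 : 0 < e / 2 by rewrite divr_gt0.
have [N NP] := key _ e20; exists N => n nN; rewrite l2_norm_lt //.
have h := NP n nN; rewrite -lte_fin fineK; last first.
  by rewrite ge0_fin_numE ?nsum_ge0 //; exact: l2P.
apply: le_lt_trans h _; rewrite lte_fin ltr_pXn2r ?nnegrE ?ltW //.
by rewrite ltr_pdivrMr // ltr_pMr // ltr1n.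
Qed.

Definition l2_space : hilbertSpace R := HilbertSpace l2_complete.

Lemma l2_basis_subproof (k : I) : (fun i => (i == k)%:R) \in l2_pred.
Proof.
rewrite unfold_in; apply: le_lt_trans (ltry 1); apply: nsum_ub => F.
have [kF|kF] := boolP (k \in F).
  rewrite (big_fsetD1 k kF) /= eqxx big_seq big1 => [|i].
    by rewrite /sqmod /=; lra.
  rewrite !inE => /andP[/negbTE -> _].
  by rewrite /sqmod /= expr0n addr0.
rewrite big_seq big1 // => i iF; have /negbTE -> : i != k.
  by apply: contraNneq kF => <-.
by rewrite /sqmod /= expr0n addr0.
Qed.

Definition l2_basis (k : I) : l2_space := L2 (l2_basis_subproof k).

Definition bounded_weight (w : I -> R) : Prop := exists M : R, forall i, `|w i| <= M.

(* Weighted shift along an injective successor map s on the index set, given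
   with its partial inverse p: it maps the basis vector at k to w k times the
   basis vector at s k (lemma wshift_basis). *)
Definition wshift_fun (p : I -> option I) (w : I -> R) (x : I -> R[i]) :
    I -> R[i] :=
  fun i => if p i is Some k then (w k)%:C * x k else 0.

Section wshift.
Variables (s : I -> I) (p : I -> option I) (ps : ocancel p s).
Variables (w : I -> R) (bw : bounded_weight w).

Lemma wshift_nsum (M : R) (x : l2) : (forall i, `|w i| <= M) ->
  (nsum (fun i => sqmod (wshift_fun p w x i)) <=
     (M ^+ 2)%:E * nsum (fun i => sqmod (x i)))%E.
Proof.
move=> wM.
have xf : nsum (fun i => sqmod (x i)) \is a fin_num.
  by rewrite ge0_fin_numE ?nsum_ge0 //; exact: l2P.
rewrite -(fineK xf) -EFinM; apply: nsum_ub => F.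
pose h k := sqmod (x k).
apply: (@le_trans _ _ (\sum_(i <- F) (if p i is Some k then M ^+ 2 * h k else 0))).
  apply: ler_sum => i _; rewrite /wshift_fun; case: (p i) => [k|]; last first.
    by rewrite /sqmod /= expr0n addr0.
  rewrite sqmodM ler_wpM2r ?sqmod_ge0 // /sqmod /= expr0n addr0.
  rewrite -real_normK ?num_real // ler_pXn2r ?nnegrE ?(le_trans (normr_ge0 _) (wM k)) //.
have -> : \sum_(i <- F) (if p i is Some k then M ^+ 2 * h k else 0) =
          M ^+ 2 * \sum_(k <- pmap p F) h k.
  rewrite mulr_sumr; elim: (enum_fset F) => [|i t IH]; first by rewrite !big_nil.
  by rewrite big_cons IH /=; case: (p i) => [k|] /=; rewrite ?big_cons ?add0r.
apply: ler_wpM2l; first exact: sqr_ge0.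
have up : uniq (pmap p F) by apply: (pmap_uniq ps); exact: fset_uniq.
have -> : \sum_(k <- pmap p F) h k = \sum_(k <- [fset k in pmap p F]%fset) h k.
  by apply: perm_big; apply: uniq_perm => // k; rewrite in_fset.
rewrite -lee_fin fineK //; exact: (@nsum_lb _ _ h _ (fun k => sqmod_ge0 (x k))).
Qed.

Lemma wshift_subproof (x : l2) : wshift_fun p w x \in l2_pred.
Proof.
have [M wM] := bw; rewrite unfold_in; apply: le_lt_trans (wshift_nsum x wM) _.
have xf : nsum (fun i => sqmod (x i)) \is a fin_num.
  by rewrite ge0_fin_numE ?nsum_ge0 //; exact: l2P.
by rewrite -(fineK xf) -EFinM ltry.
Qed.

Definition wshift_op (x : l2_space) : l2_space := L2 (wshift_subproof x).

Lemma wshift_linear : linear wshift_op.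
Proof.
move=> a x y; apply/val_inj/funext => i /=.
rewrite -[RHS]/(a * wshift_fun p w x i + wshift_fun p w y i) /wshift_fun.
case: (p i) => [k|]; last by rewrite mulr0 addr0.
by rewrite -[LHS]/((w k)%:C * (a * x k + y k)) mulrDr mulrCA.
Qed.

HB.instance Definition _ :=
  GRing.isLinear.Build R[i] l2_space l2_space _ wshift_op wshift_linear.

Definition wshift : {linear l2_space -> l2_space} := wshift_op.

Lemma wshift_bounded : bounded_op wshift.
Proof.
have [M wM] := bw; exists (Num.sqrt (M ^+ 2)) => x.
rewrite /hnorm !l2_normE -sqrtrM ?sqr_ge0 // ler_sqrt; last first.
  by rewrite mulr_ge0 ?sqr_ge0 // fine_ge0 // nsum_ge0.
have fin (u : l2) : nsum (fun i => sqmod (u i)) \is a fin_num.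
  by rewrite ge0_fin_numE ?nsum_ge0 //; exact: l2P.
by rewrite -lee_fin EFinM !fineK // wshift_nsum.
Qed.

Lemma wshift_basis (k : I) : pcancel s p ->
  wshift (l2_basis k) = (w k)%:C *: l2_basis (s k).
Proof.
move=> sp; apply/val_inj/funext => i /=.
rewrite -[RHS]/((w k)%:C * (i == s k)%:R) /wshift_fun.
case pi : (p i) => [m|] /=.
  have <- : s m = i by have := ps i; rewrite pi.
  by rewrite (can_eq (g := fun j => odflt m (p j))) => [|j]; 
    [have [->|_] := eqVneq m k; rewrite ?mulr0|rewrite sp].
have [ik|_] := eqVneq i (s k); last by rewrite mulr0.
by move: pi; rewrite ik sp.
Qed.

End wshift.
End l2.

Arguments l2 : clear implicits.
Arguments l2_space : clear implicits.

Section shifts.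
Context {R : realType}.

Definition nat_pred_opt (n : nat) : option nat :=
  if n is m.+1 then Some m else None.

Lemma nat_pred_optK : ocancel nat_pred_opt S.
Proof. by case. Qed.

Definition shift (w : nat -> R) (bw : bounded_weight w) :
    {linear l2_space R nat -> l2_space R nat} := wshift nat_pred_optK bw.

Lemma shift_basis (w : nat -> R) (bw : bounded_weight w) (n : nat) :
  shift bw (l2_basis n) = (w n)%:C *: l2_basis n.+1.
Proof. exact: wshift_basis. Qed.

Definition succ1 (k : nat * nat) : nat * nat := (k.1.+1, k.2).
Definition succ2 (k : nat * nat) : nat * nat := (k.1, k.2.+1).

Definition pred1_opt (k : nat * nat) : option (nat * nat) :=
  if k.1 is m.+1 then Some (m, k.2) else None.
Definition pred2_opt (k : nat * nat) : option (nat * nat) :=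
  if k.2 is m.+1 then Some (k.1, m) else None.

Lemma pred1_optK : ocancel pred1_opt succ1.
Proof. by case=> [[|i] j]. Qed.

Lemma pred2_optK : ocancel pred2_opt succ2.
Proof. by case=> [i [|j]]. Qed.

Definition shift1 (alpha : nat * nat -> R) (ba : bounded_weight alpha) :
    {linear l2_space R (nat * nat)%type -> l2_space R (nat * nat)%type} :=
  wshift pred1_optK ba.

Definition shift2 (beta : nat * nat -> R) (bb : bounded_weight beta) :
    {linear l2_space R (nat * nat)%type -> l2_space R (nat * nat)%type} :=
  wshift pred2_optK bb.

Lemma shift1_basis (alpha : nat * nat -> R) (ba : bounded_weight alpha) i j :
  shift1 ba (l2_basis (i, j)) = (alpha (i, j))%:C *: l2_basis (i.+1, j).
Proof. by apply: wshift_basis; case. Qed.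

Lemma shift2_basis (beta : nat * nat -> R) (bb : bounded_weight beta) i j :
  shift2 bb (l2_basis (i, j)) = (beta (i, j))%:C *: l2_basis (i, j.+1).
Proof. by apply: wshift_basis; case. Qed.

Lemma bounded_row (alpha : nat * nat -> R) (ba : bounded_weight alpha) (j : nat) :
  bounded_weight (fun i => alpha (i, j)).
Proof. by have [M aM] := ba; exists M. Qed.

Lemma bounded_col (beta : nat * nat -> R) (bb : bounded_weight beta) (i : nat) :
  bounded_weight (fun j => beta (i, j)).
Proof. by have [M bM] := bb; exists M. Qed.

End shifts.

(* Main.v *)
Require Import Defs.
From HB Require Import structures.
From mathcomp Require Import all_boot all_order all_algebra sesquilinear complex finmap.
From mathcomp Require Import all_classical all_reals.
From mathcomp Require Import ring lra.

(** The norm of a weighted shift with positive weights is the supremum of its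
    weights, so the claim is that two consecutive horizontal slices at height at
    least 1 have the same upper bounds on their weights; the vertical slices
    follow by exchanging the two coordinates.

    Let N and Q be the commuting normal extensions of the two shifts and let
    M_c be the spectral subspace of N for the disc of radius c.  It consists of
    the vectors m for which the norms of the iterates N^n m grow at most like
    r^n for every r > c, and every m in M_c satisfies |N m| <= c |m|
    ([growth_le_hnorm]).  Hence the weights of a horizontal slice are at most c
    exactly when all basis vectors of that slice lie in M_c ([row_growth]).

    Q commutes with N, so it maps M_c into itself.  Conversely, if Q (Q x) lies
    in M_c then so does Q x ([growth_le_cancel]): M_c reduces Q, and Q, being
    normal, is injective on the closure of its range.  A basis vector at height
    at least 1 is a multiple of Q x for some x, whereas one at height 0 need not
    be in the range of Q; this is why height 0 is excluded.  Together these two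
    facts say that the basis vectors at height j + 1 lie in M_c if and only if
    those at height j + 2 do.

    That M_c reduces Q is the part of Fuglede's theorem that is needed: the
    adjoint of Q also preserves M_c ([growth_le_adj]).  It is proved without the
    spectral theorem.  Given r > c and n, gradient descent for the quadratic form
    |N^n x|^2 splits any w as z + N^n g with |N^n z| <= r^n |w| and
    |g| <= 2 r^-n |w| ([spectral_split]), an approximation of the spectral
    projection for the disc of radius r.  If w = Q^* m with m in M_c, the pairing
    of N^n g with w is the pairing of Q g with the n-th iterate of the adjoint of
    N on m, which tends to 0 because |N^n m| = o(r^n); so z tends to w as n grows
    and w inherits the growth bound of z.

    Only real parts of inner products occur below: the coefficients involved are
    all real, and adjoints for the complex inner product are adjoints for its
    real part. *)

Set Implicit Arguments.
Unset Strict Implicit.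
Unset Printing Implicit Defensive.
Import Order.TTheory GRing.Theory Num.Theory.
Local Open Scope ring_scope.
Local Open Scope complex_scope.

(** * The real part of the inner product *)

Section RealInnerProduct.
Context {R : realType} {H : hilbertSpace R}.
Implicit Types x y z : H.

Definition rdot x y : R := complex.Re (inner H x y).

Lemma rdotC x y : rdot x y = rdot y x.
Proof. by rewrite /rdot hermC /= expr0 mul1r; case: (inner H y x). Qed.

Lemma rdotDl x y z : rdot (x + y) z = rdot x z + rdot y z.
Proof.
by rewrite /rdot linearDl /=; case: (inner H x z) (inner H y z) => [a b] [c d].
Qed.

Lemma rdotZl (t : R) x z : rdot (t%:C *: x) z = t * rdot x z.
Proof.
rewrite /rdot linearZl_LR /=; case: (inner H x z) => a b /=.
by rewrite mul0r subr0.
Qed.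

Lemma rdotBl x y z : rdot (x - y) z = rdot x z - rdot y z.
Proof. by rewrite -scaleN1r -(rmorphN1 (real_complex R)) rdotDl rdotZl mulN1r. Qed.

Lemma rdotBr x y z : rdot x (y - z) = rdot x y - rdot x z.
Proof. by rewrite !(rdotC x) rdotBl. Qed.

Lemma rdotZr (t : R) x z : rdot x (t%:C *: z) = t * rdot x z.
Proof. by rewrite !(rdotC x) rdotZl. Qed.

Lemma rdot_ge0 x : 0 <= rdot x x.
Proof. by have := dnorm_ge0 (inner H) x; rewrite /rdot lecE /= => /andP[]. Qed.

Lemma hnorm_ge0 x : 0 <= hnorm x.
Proof. exact: sqrtr_ge0. Qed.

Lemma hnorm_sqr x : hnorm x ^+ 2 = rdot x x.
Proof. by rewrite sqr_sqrtr ?rdot_ge0. Qed.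

Lemma hnorm_gt0 x : x != 0 -> 0 < hnorm x.
Proof.
move=> x0; have := neq0_dnorm_gt0 (s := inner H) x x0.
by rewrite sqrtr_gt0 ltcE => /andP[].
Qed.

Lemma le_sqr_hnorm x (M : R) : 0 <= M -> (hnorm x <= M) = (hnorm x ^+ 2 <= M ^+ 2).
Proof. by move=> M0; rewrite ler_pXn2r ?nnegrE ?hnorm_ge0. Qed.

Lemma rdot_le x y : rdot x y <= hnorm x * hnorm y.
Proof.
have [->|y0] := eqVneq y 0.
  by rewrite -(scale0r (0 : H)) rdotZr mul0r mulr_ge0 ?hnorm_ge0.
have yp := hnorm_gt0 y0.
have := rdot_ge0 ((hnorm y)%:C *: x - (hnorm x)%:C *: y).
rewrite rdotBl !rdotBr !rdotZl !rdotZr -!hnorm_sqr (rdotC y x) => h.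
have [x0|x0] := eqVneq x 0.
  by rewrite x0 -(scale0r (0 : H)) rdotZl mul0r mulr_ge0 ?hnorm_ge0.
have xp := hnorm_gt0 x0.
rewrite -(ler_pM2l (mulr_gt0 xp yp)); nra.
Qed.

Lemma ler_hnormD x y : hnorm (x + y) <= hnorm x + hnorm y.
Proof.
rewrite le_sqr_hnorm ?addr_ge0 ?hnorm_ge0 // hnorm_sqr rdotDl !(rdotC _ (x + y)).
rewrite !rdotDl -!hnorm_sqr (rdotC y x).
have := rdot_le x y; lra.
Qed.

Lemma hnormZ (t : R) x : hnorm (t%:C *: x) = `|t| * hnorm x.
Proof.
apply/eqP; rewrite -(@eqrXn2 _ 2) ?mulr_ge0 ?hnorm_ge0 //.
by rewrite hnorm_sqr rdotZl rdotZr -hnorm_sqr exprMn real_normK ?num_real // mulrA.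
Qed.

Lemma hnormN x : hnorm (- x) = hnorm x.
Proof. by rewrite -scaleN1r -(rmorphN1 (real_complex R)) hnormZ normrN1 mul1r. Qed.

End RealInnerProduct.

(** * Gradient descent and the approximate spectral projection *)

Section Descent.
Context {R : realType} {K : hilbertSpace R}.
Implicit Types A B P : {linear K -> K}.

Lemma rdot_adj A B x y : is_adjoint A B -> rdot (A x) y = rdot x (B y).
Proof. by move=> AB; rewrite /rdot AB. Qed.

Lemma rdot_adjl A B x y : is_adjoint A B -> rdot (B x) y = rdot x (A y).
Proof. by move=> AB; rewrite rdotC -(rdot_adj _ _ AB) rdotC. Qed.

Lemma hnorm_adj A B : is_adjoint A B -> (forall x, A (B x) = B (A x)) ->
  forall x, hnorm (B x) = hnorm (A x).
Proof.
move=> AB cAB x; apply/eqP; rewrite -(@eqrXn2 _ 2) ?hnorm_ge0 //.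
by rewrite !hnorm_sqr (rdot_adjl _ _ AB) (rdot_adj _ _ AB) cAB.
Qed.

(** With B adjoint to A, this is a gradient step of size t for half of the
    quadratic form |A x|^2: it damps the part of x on which A is large. *)
Definition descent A B (t : R) (x : K) : K := x - t%:C *: B (A x).

Section descent_theory.
Variables (A B : {linear K -> K}) (t b : R).
Hypotheses (AB : is_adjoint A B) (cAB : forall x, A (B x) = B (A x)).
Hypotheses (Ab : forall x, hnorm (A x) ^+ 2 <= b * hnorm x ^+ 2).
Hypotheses (t0 : 0 <= t) (tb : t * b <= 1).
Local Notation D := (descent A B t).

(** Expanding the square leaves a term t^2 |B (A x)|^2, which normality and the
    bound on A absorb into half of the cross term. *)
Lemma descent_energy x :
  t * hnorm (A x) ^+ 2 + hnorm (D x) ^+ 2 <= hnorm x ^+ 2.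
Proof.
have eD : hnorm (D x) ^+ 2 =
    hnorm x ^+ 2 - 2 * t * hnorm (A x) ^+ 2 + t ^+ 2 * hnorm (B (A x)) ^+ 2.
  rewrite !hnorm_sqr rdotBl !rdotBr !rdotZl !rdotZr.
  rewrite (rdot_adjl _ _ AB) -(rdot_adj _ _ AB); ring.
have h : t * hnorm (B (A x)) ^+ 2 <= hnorm (A x) ^+ 2.
  rewrite (hnorm_adj AB cAB) (le_trans (ler_wpM2l t0 (Ab _))) // mulrA.
  by rewrite ler_piMl ?sqr_ge0.
have := ler_wpM2l t0 h; rewrite eD; nra.
Qed.

Lemma hnorm_descent x : hnorm (D x) <= hnorm x.
Proof.
rewrite le_sqr_hnorm ?hnorm_ge0 //; apply: le_trans (descent_energy x).
by rewrite lerDr mulr_ge0 ?sqr_ge0.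
Qed.

Lemma descentC P : (forall x, P (A x) = A (P x)) -> (forall x, P (B x) = B (P x)) ->
  forall x, P (D x) = D (P x).
Proof. by move=> PA PB x; rewrite /descent linearB linearZ /= PB PA. Qed.

Lemma iter_descentC k x : A (iter k D x) = iter k D (A x).
Proof. by elim: k => //= k <-; rewrite descentC. Qed.

(** The energies t |A u|^2 given up at successive steps sum to at most |x|^2, and
    they decrease because A commutes with the steps; so k times the last one is
    at most |x|^2. *)
Lemma iter_descent_energy k x :
  k%:R * (t * hnorm (A (iter k D x)) ^+ 2) + hnorm (iter k D x) ^+ 2
    <= hnorm x ^+ 2.
Proof.
elim: k => [|k IH]; first by rewrite mul0r add0r.
apply: le_trans IH; set u := iter k D x.
apply: le_trans (lerD (lexx _) (descent_energy u)).
rewrite addrA lerD2r [iter k.+1 D x]/(D u) mulrSr mulrDl mul1r.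
have h : t * hnorm (A (D u)) ^+ 2 <= t * hnorm (A u) ^+ 2.
  apply: ler_wpM2l => //; rewrite descentC //.
  by rewrite ler_pXn2r ?nnegrE ?hnorm_ge0 // hnorm_descent.
by apply: lerD => //; apply: ler_wpM2l.
Qed.

Lemma hnorm_iter_descent k x : hnorm (iter k D x) <= hnorm x.
Proof. by elim: k => //= k; apply: le_trans (hnorm_descent _). Qed.

(** The steps telescope, and each of them is t B A applied to an iterate; so s is
    the sum of the first k iterates, which have norm at most |x|. *)
Lemma iter_descent_telescope k x :
  exists s : K, x - iter k D x = t%:C *: B (A s) /\ hnorm s <= k%:R * hnorm x.
Proof.
elim: k => [|k [s [es ns]]].
  exists 0; rewrite !linear0 subrr; split=> //.
  by rewrite mul0r -(scale0r (0 : K)) hnormZ normr0 mul0r.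
exists (s + iter k D x); split.
  by rewrite iterS {1}/descent opprB addrA addrAC es !linearD.
rewrite (le_trans (ler_hnormD _ _)) // mulrSr mulrDl mul1r lerD //.
exact: hnorm_iter_descent.
Qed.

Lemma rdot_descent k x y : rdot (iter k D x) y = rdot x (iter k D y).
Proof.
elim: k y => // k IH y.
rewrite [in RHS]iterSr -IH [in LHS]iterS [X in rdot X _ = _]/descent.
by rewrite rdotBl rdotBr rdotZl rdotZr (rdot_adjl _ _ AB) (rdot_adj _ _ AB).
Qed.

End descent_theory.

(** An approximation of the spectral decomposition of w for the normal operator
    A at radius r: z is the component where A is at most r, and on the other
    component A is invertible with inverse of size about 1 / r.  Take z to be the
    result of k descent steps of size 1 / (k r^2), with k large.  The inequality
    on A g expresses that both components have nonnegative pairing. *)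
Lemma spectral_split A B (b r : R) :
  is_adjoint A B -> (forall x, A (B x) = B (A x)) ->
  (forall x, hnorm (A x) ^+ 2 <= b * hnorm x ^+ 2) -> 0 < r ->
  forall w, exists z g : K,
    [/\ w = z + A g, hnorm z <= hnorm w, hnorm (A z) <= r * hnorm w,
        hnorm (A g) ^+ 2 <= rdot (A g) w & hnorm g <= 2 / r * hnorm w].
Proof.
move=> AB cAB Ab r0 w.
have r20 : 0 < r ^+ 2 by rewrite exprn_gt0.
(* The number of steps is even so that [z] and the half-way iterate [h] satisfy
   [rdot z w = hnorm h ^+ 2 >= hnorm z ^+ 2]. *)
pose p := (Num.bound (`|b| / r ^+ 2)).+1; pose k := (p + p)%N.
have k0 : (0 : R) < k%:R by rewrite ltr0n.
have bk : b <= k%:R * r ^+ 2.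
  rewrite (le_trans (ler_norm b)) // -ler_pdivrMr //.
  have h : 0 <= `|b| / r ^+ 2 by rewrite divr_ge0 ?sqr_ge0.
  have := archi_boundP h; move=> /ltW h1; apply: le_trans h1 _.
  by rewrite ler_nat /k; apply: leq_trans (leq_addr p p).
pose t : R := (k%:R * r ^+ 2)^-1.
have kr0 : 0 < k%:R * r ^+ 2 by rewrite mulr_gt0.
have t0 : 0 < t by rewrite invr_gt0.
have tb : t * b <= 1 by rewrite /t mulrC ler_pdivrMr // mul1r.
have kt : k%:R * t = (r ^+ 2)^-1 by rewrite /t invfM mulrA divff ?mul1r ?gt_eqF.
clearbody t.
have [s [es ns]] := iter_descent_telescope AB cAB Ab (ltW t0) tb k w.
pose D := descent A B t; pose z := iter k D w.
have zw : hnorm z <= hnorm w := hnorm_iter_descent AB cAB Ab (ltW t0) tb k w.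
have Ag : A (t%:C *: B s) = w - z by rewrite linearZ /= cAB -es.
exists z, (t%:C *: B s); rewrite Ag; split=> //.
- by rewrite addrC subrK.
- rewrite le_sqr_hnorm ?mulr_ge0 ?hnorm_ge0 ?(ltW r0) //.
  have := iter_descent_energy AB cAB Ab (ltW t0) tb k w.
  rewrite -/D -/z mulrA kt exprMn => h.
  have : (r ^+ 2)^-1 * hnorm (A z) ^+ 2 <= hnorm w ^+ 2.
    by apply: le_trans h; rewrite lerDl sqr_ge0.
  by rewrite mulrC ler_pdivrMr // mulrC.
- have zz : hnorm z ^+ 2 <= rdot z w.
    rewrite {2}/z /k iterD (rdot_descent t AB) -hnorm_sqr /z /k iterD.
    rewrite ler_pXn2r ?nnegrE ?hnorm_ge0 //.
    exact: hnorm_iter_descent AB cAB Ab (ltW t0) tb _ _.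
  rewrite hnorm_sqr rdotBr gerBl rdotBl (rdotC w z) -hnorm_sqr; lra.
- rewrite hnormZ gtr0_norm // (hnorm_adj AB cAB).
  rewrite -(@ler_pXn2r _ 2) ?nnegrE ?mulr_ge0 ?hnorm_ge0 ?invr_ge0 ?(ltW r0) ?(ltW t0) //.
  have e : t * hnorm (A s) ^+ 2 = rdot (w - z) s.
    by rewrite /z /D es rdotZl (rdot_adjl _ _ AB) hnorm_sqr.
  have wz : hnorm (w - z) <= 2 * hnorm w.
    by have := ler_hnormD w (- z); rewrite hnormN; lra.
  have h : t * hnorm (A s) ^+ 2 <= 2 * hnorm w * (k%:R * hnorm w).
    rewrite e (le_trans (rdot_le _ _)) // ler_pM ?hnorm_ge0 //.
  have := ler_wpM2l (ltW t0) h.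
  have -> : t * (2 * hnorm w * (k%:R * hnorm w)) = k%:R * t * 2 * hnorm w ^+ 2 by ring.
  rewrite kt !exprMn exprVn => h1.
  have : 0 <= (r ^+ 2)^-1 * hnorm w ^+ 2 by rewrite mulr_ge0 ?invr_ge0 ?sqr_ge0 ?(ltW r20).
  nra.
Qed.

End Descent.

(** * Powers of a normal operator *)

Section LinPow.
Context {R : realType} {K : hilbertSpace R}.
Implicit Types N B P : {linear K -> K}.

(** The same function as the iterate, with its linear structure. *)
Fixpoint lin_pow N n : {linear K -> K} :=
  if n is m.+1 then N \o lin_pow N m else idfun.

Lemma lin_powE N n x : lin_pow N n x = iter n N x.
Proof. by elim: n => //= n ->. Qed.

Lemma iterC (f g : K -> K) n : (forall x, f (g x) = g (f x)) ->
  forall x, iter n f (g x) = g (iter n f x).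
Proof. by move=> fg x; elim: n => //= n ->. Qed.

Lemma lin_pow_adj N B n : is_adjoint N B -> is_adjoint (lin_pow N n) (lin_pow B n).
Proof.
move=> NB x y; rewrite !lin_powE; elim: n y => //= n IH y.
by rewrite NB IH iterC.
Qed.

Lemma lin_powC N B n : (forall x, N (B x) = B (N x)) ->
  forall x, lin_pow N n (lin_pow B n x) = lin_pow B n (lin_pow N n x).
Proof.
move=> NB x; rewrite !lin_powE; apply: (@iterC N (iter n B)) => u.
by rewrite (@iterC B N).
Qed.

Lemma hnorm_iter N (L : R) n x : 0 <= L -> (forall x, hnorm (N x) <= L * hnorm x) ->
  hnorm (iter n N x) <= L ^+ n * hnorm x.
Proof.
move=> L0 NL; elim: n => [|n IH]; first by rewrite expr0 mul1r.
by rewrite iterS (le_trans (NL _)) // exprS -mulrA ler_wpM2l.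
Qed.

Lemma bounded_op_ge0 N : bounded_op N ->
  exists2 L : R, 0 <= L & forall x, hnorm (N x) <= L * hnorm x.
Proof.
move=> [M NM]; exists `|M| => // x; apply: le_trans (NM x) _.
by rewrite ler_wpM2r ?hnorm_ge0 ?ler_norm.
Qed.

(** A log-convex sequence that starts at or below s and exceeds it is
    nondecreasing from then on, hence is still above s at index n. *)
Lemma log_convex_le (u : nat -> R) (s : R) n : 0 <= s -> (forall k, 0 <= u k) ->
  (forall k, u k.+1 ^+ 2 <= u k * u k.+2) ->
  u 0%N <= s -> u n <= s -> forall l, (l <= n)%N -> u l <= s.
Proof.
move=> s0 u_ge0 cvx u0 un l ln; rewrite leNgt; apply/negP => sl.
have incr k : s < u k -> u k <= u k.+1.
  elim: k => [|k IH] sk; first by move: (lt_le_trans sk u0); rewrite ltxx.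
  have kk : u k <= u k.+1.
    by have [/IH //|uk] := ltP s (u k); apply: le_trans uk (ltW sk).
  have uk0 : 0 < u k.+1 by apply: le_lt_trans sk.
  rewrite -(ler_pM2l uk0) -expr2; apply: le_trans (cvx k) _.
  by rewrite ler_wpM2r.
suff : s < u n by rewrite ltNge un.
rewrite -(subnK ln); elim: (n - l)%N => // d IH.
by rewrite addSn; apply: lt_le_trans IH (incr _ IH).
Qed.

Lemma normal_log_convex N B x : is_adjoint N B -> (forall x, N (B x) = B (N x)) ->
  hnorm (N x) ^+ 2 <= hnorm x * hnorm (N (N x)).
Proof.
move=> NB cNB; rewrite hnorm_sqr (rdot_adj _ _ NB) (le_trans (rdot_le _ _)) //.
by rewrite (hnorm_adj NB cNB).
Qed.

Lemma normal_interpolation N B (r s : R) n z :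
  is_adjoint N B -> (forall x, N (B x) = B (N x)) -> 0 < r -> 0 <= s ->
  hnorm z <= s -> hnorm (iter n N z) <= r ^+ n * s ->
  forall l, (l <= n)%N -> hnorm (iter l N z) <= r ^+ l * s.
Proof.
move=> NB cNB r0 s0 zs zn l ln.
have rk k : 0 < r ^+ k by rewrite exprn_gt0.
rewrite mulrC -ler_pdivrMr //.
apply: (@log_convex_le (fun k => hnorm (iter k N z) / r ^+ k) s n) => //.
- by move=> k; rewrite divr_ge0 ?hnorm_ge0 ?ltW.
- move=> k; rewrite exprMn exprVn -exprM mulrACA -invfM -exprD.
  rewrite (_ : (k.+1 * 2 = k + k.+2)%N); last by rewrite muln2 -addnn addSnnS.
  by rewrite ler_wpM2r ?invr_ge0 ?(ltW (rk _)) // (normal_log_convex _ NB).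
- by rewrite expr0 divr1.
- by rewrite ler_pdivrMr // mulrC.
Qed.

End LinPow.

(** * Vectors of bounded growth *)

Section Growth.
Context {R : realType} {K : hilbertSpace R}.
Implicit Types (N B P Q : {linear K -> K}) (c r : R).

(** The local spectral radius of N at m is at most c.  Quantifying over r > c
    makes an arbitrarily small loss of radius in the estimates harmless. *)
Definition growth_le N (c : R) (m : K) : Prop :=
  forall r, c < r -> exists C : R, forall n, hnorm (iter n N m) <= C * r ^+ n.

Lemma growth_leD N c m1 m2 : growth_le N c m1 -> growth_le N c m2 ->
  growth_le N c (m1 + m2).
Proof.
move=> g1 g2 r cr; have [C1 h1] := g1 r cr; have [C2 h2] := g2 r cr.
exists (C1 + C2) => n; rewrite -lin_powE linearD !lin_powE.
by rewrite (le_trans (ler_hnormD _ _)) // mulrDl lerD.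
Qed.

Lemma growth_leZ N c (t : R) m : growth_le N c m -> growth_le N c (t%:C *: m).
Proof.
move=> g r cr; have [C h] := g r cr.
exists (`|t| * C) => n; rewrite -lin_powE linearZ lin_powE /= hnormZ -mulrA.
by rewrite ler_wpM2l.
Qed.

Lemma growth_leB N c m1 m2 : growth_le N c m1 -> growth_le N c m2 ->
  growth_le N c (m1 - m2).
Proof.
move=> g1 g2; rewrite -scaleN1r -(rmorphN1 (real_complex R)).
by apply: growth_leD => //; exact: growth_leZ.
Qed.

Lemma growth_le_comm N c P m : bounded_op P -> (forall x, N (P x) = P (N x)) ->
  growth_le N c m -> growth_le N c (P m).
Proof.
move=> /bounded_op_ge0[L L0 PL] NP g r cr; have [C h] := g r cr.
exists (L * C) => n; rewrite iterC // (le_trans (PL _)) // -mulrA.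
by rewrite ler_wpM2l.
Qed.

Lemma geometric_small (E q d : R) l : 0 <= q -> q < 1 -> 0 < d ->
  exists2 n, (l <= n)%N & E * q ^+ n < d.
Proof.
move=> q0 q1 d0; pose h := 1 - q.
have h0 : 0 < h by rewrite subr_gt0.
have bernoulli n : (1 + n%:R * h) * q ^+ n <= 1.
  elim: n => [|n IH]; first by rewrite mul0r addr0 mul1r.
  apply: le_trans IH; rewrite exprS mulrA ler_wpM2r ?exprn_ge0 // mulrSr /h.
  by have := mulr_ge0 (ler0n R n) (sqr_ge0 (1 - q)); nra.
pose p := Num.bound (`|E| / (d * h)); exists (p + l)%N; first exact: leq_addl.
have dh : 0 < d * h by rewrite mulr_gt0.
have /archi_boundP : 0 <= `|E| / (d * h) by rewrite divr_ge0 // ltW.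
rewrite -/p ltr_pdivrMr // => Ep.
set n := (p + l)%N.
have pn : p%:R * (d * h) <= n%:R * (d * h).
  by rewrite ler_pM2r // ler_nat leq_addr.
have qn : 0 <= q ^+ n by rewrite exprn_ge0.
apply: le_lt_trans (ler_wpM2r qn (ler_norm E)) _.
have En : `|E| < d * (1 + n%:R * h) by lra.
have [->|q_neq0] := eqVneq (q ^+ n) 0; first by rewrite mulr0.
have qp : 0 < q ^+ n by rewrite lt_def q_neq0.
apply: lt_le_trans (_ : d * (1 + n%:R * h) * q ^+ n <= d).
  by rewrite ltr_pM2r.
by rewrite -mulrA ler_piMr // ltW.
Qed.

(** The part of Fuglede's theorem that is needed, with an explicit constant.  In
    the decomposition of w = P' m at radius r for the n-th power of N, the
    component A g, where A is that power, pairs with w as P g does with the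
    image of m under the adjoint of A.  By normality the latter is as small as
    the n-th iterate of m, and A g tends to 0. *)
Lemma hnorm_iter_adj N P P' c m r l :
  normal_op N -> bounded_op P -> is_adjoint P P' ->
  (forall x, N (P x) = P (N x)) -> 0 <= c -> growth_le N c m -> c < r ->
  hnorm (iter l N (P' m)) <= r ^+ l * hnorm (P' m).
Proof.
move=> [/bounded_op_ge0[L L0 NL] [B [NB cNB]]] /bounded_op_ge0[M M0 PM] PP' NP.
move=> c0 gm cr; set w := P' m.
(* The growth of [m] is measured at a radius strictly below [r], to leave a
   geometric factor [(r1 / r) ^+ n] that tends to 0. *)
pose r1 := (c + r) / 2.
have [c1 r1r] : c < r1 /\ r1 < r by rewrite /r1; split; lra.
have r0 : 0 < r by lra.
have [C mC] := gm r1 c1.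
pose q := r1 / r; pose E := M * (2 * hnorm w) * C.
have q0 : 0 <= q by rewrite divr_ge0 //; lra.
have q1 : q < 1 by rewrite ltr_pdivrMr // mul1r.
apply/ler_addgt0Pr => e e0.
have Ll0 : 0 < L ^+ l + 1 by rewrite ltr_wpDl ?exprn_ge0.
pose d := e / (L ^+ l + 1).
have d0 : 0 < d by rewrite divr_gt0.
have [n ln En] := geometric_small E l q0 q1 (exprn_gt0 2 d0).
have rn : 0 < r ^+ n by rewrite exprn_gt0.
have An x : hnorm (lin_pow N n x) ^+ 2 <= (L ^+ n) ^+ 2 * hnorm x ^+ 2.
  rewrite lin_powE -exprMn ler_pXn2r ?nnegrE ?mulr_ge0 ?exprn_ge0 ?hnorm_ge0 //.
  exact: hnorm_iter.
have AB := lin_pow_adj n NB; have cAB := lin_powC n cNB.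
have [z [g [wE zw Az Ag gw]]] := spectral_split AB cAB An rn w.
have vE : hnorm (lin_pow N n g) ^+ 2 <= E * q ^+ n.
  rewrite (le_trans Ag) // -(rdot_adj _ _ PP') -/w lin_powE -iterC; last first.
    by move=> x; rewrite NP.
  rewrite -lin_powE (rdot_adj _ _ AB) (le_trans (rdot_le _ _)) //.
  rewrite (hnorm_adj AB cAB) lin_powE.
  have -> : E * q ^+ n = M * (2 / r ^+ n * hnorm w) * (C * r1 ^+ n).
    by rewrite /E /q exprMn exprVn; ring.
  rewrite ler_pM ?hnorm_ge0 // (le_trans (PM _)) // ler_wpM2l //.
have vd : hnorm (lin_pow N n g) <= d.
  by rewrite le_sqr_hnorm ?(ltW d0) // (le_trans vE) // ltW.
rewrite {1}wE -lin_powE linearD !lin_powE (le_trans (ler_hnormD _ _)) // lerD //.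
  apply: (normal_interpolation NB cNB r0 (hnorm_ge0 _) zw _ ln).
  by rewrite -lin_powE.
rewrite (le_trans (hnorm_iter _ _ L0 NL)) // -lin_powE.
apply: (@le_trans _ _ ((L ^+ l + 1) * d)).
  by rewrite ler_pM ?exprn_ge0 ?hnorm_ge0 ?lerDl.
by rewrite /d mulrC divfK ?gt_eqF.
Qed.

Lemma growth_le_adj N P P' c m :
  normal_op N -> bounded_op P -> is_adjoint P P' ->
  (forall x, N (P x) = P (N x)) -> 0 <= c -> growth_le N c m ->
  growth_le N c (P' m).
Proof.
move=> nN bP PP' NP c0 gm r cr; exists (hnorm (P' m)) => n.
rewrite mulrC; exact: hnorm_iter_adj nN bP PP' NP c0 gm cr.
Qed.

(** The case of the identity in [hnorm_iter_adj]: the constant in a growth bound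
    can be taken to be the norm of the vector, and the radius can be c itself. *)
Lemma growth_le_hnorm N c m : normal_op N -> 0 <= c -> growth_le N c m ->
  hnorm (N m) <= c * hnorm m.
Proof.
move=> nN c0 gm; apply/ler_addgt0Pr => e e0.
have h1 : 0 < hnorm m + 1 by rewrite ltr_wpDl ?hnorm_ge0.
have cr : c < c + e / (hnorm m + 1) by rewrite ltrDl divr_gt0.
have bI : bounded_op (idfun : {linear K -> K}) by exists 1 => x; rewrite mul1r.
have := @hnorm_iter_adj N idfun idfun c m _ 1%N nN bI (fun _ _ => erefl)
  (fun _ => erefl) c0 gm cr.
rewrite expr1 /= => /le_trans; apply; rewrite mulrDl lerD2l.
by rewrite -mulrA ler_piMr ?(ltW e0) // mulrC ler_pdivrMr // mul1r lerDl.
Qed.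

Lemma growth_le_iter N c m n : normal_op N -> 0 <= c -> growth_le N c m ->
  hnorm (iter n N m) <= c ^+ n * hnorm m.
Proof.
move=> nN c0; elim: n m => [|n IH] m gm; first by rewrite expr0 mul1r.
have gN : growth_le N c (N m) by apply: growth_le_comm gm => //; case: nN.
rewrite iterSr (le_trans (IH _ gN)) // exprSr -mulrA ler_wpM2l ?exprn_ge0 //.
exact: growth_le_hnorm.
Qed.

(** Vectors of growth at most c satisfy the uniform bounds of
    [growth_le_iter], which pass to limits. *)
Lemma growth_le_closed N c y : normal_op N -> 0 <= c ->
  (forall e : R, 0 < e -> exists2 u, growth_le N c u & hnorm (y - u) <= e) ->
  growth_le N c y.
Proof.
move=> nN c0 ye r cr; exists (hnorm y) => n.
apply: (@le_trans _ _ (c ^+ n * hnorm y)); last first.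
  rewrite mulrC ler_wpM2l ?hnorm_ge0 // lerXn2r ?nnegrE ?(ltW cr) //.
  exact: le_trans c0 (ltW cr).
have [/bounded_op_ge0[L L0 NL] _] := nN.
apply/ler_addgt0Pr => e e0.
pose k := c ^+ n + L ^+ n + 1.
have k0 : 0 < k by rewrite ltr_wpDl ?addr_ge0 ?exprn_ge0.
have [u gu yu] := ye _ (divr_gt0 e0 k0); set d := e / k in yu.
have un : hnorm u <= hnorm y + d.
  have := ler_hnormD y (- (y - u)); rewrite opprB addrC subrK.
  rewrite -opprB hnormN; lra.
have -> : iter n N y = iter n N u + iter n N (y - u).
  by rewrite -!lin_powE -linearD addrC subrK.
rewrite (le_trans (ler_hnormD _ _)) //.
have h1 := le_trans (growth_le_iter n nN c0 gu) (ler_wpM2l (exprn_ge0 n c0) un).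
have h2 := le_trans (hnorm_iter n (y - u) L0 NL) (ler_wpM2l (exprn_ge0 n L0) yu).
have -> : e = k * d by rewrite /d mulrC divfK ?gt_eqF.
have d0 : 0 < d by rewrite divr_gt0.
rewrite /k; nra.
Qed.

(** Descent steps for Q applied to y = Q x tend to 0, since y lies in the range
    of Q; and each step subtracts a multiple of the adjoint of Q applied to a
    vector obtained from Q y, hence a vector of growth at most c.  So y is a
    limit of vectors of growth at most c. *)
Lemma growth_le_cancel N Q c x : normal_op N -> normal_op Q ->
  (forall x, N (Q x) = Q (N x)) -> 0 <= c ->
  growth_le N c (Q (Q x)) -> growth_le N c (Q x).
Proof.
move=> nN nQ NQ c0 gQQ; apply: growth_le_closed => // e e0.
have [bQ [Q' [QQ' cQ]]] := nQ.
have [L L0 QL] := bounded_op_ge0 bQ.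
have Qb u : hnorm (Q u) ^+ 2 <= L ^+ 2 * hnorm u ^+ 2.
  by rewrite -exprMn ler_pXn2r ?nnegrE ?mulr_ge0 ?hnorm_ge0.
pose t := (L ^+ 2 + 1)^-1.
have L1 : 0 < L ^+ 2 + 1 by rewrite ltr_wpDl ?sqr_ge0.
have t0 : 0 < t by rewrite invr_gt0.
have tb : t * L ^+ 2 <= 1 by rewrite /t mulrC ler_pdivrMr // mul1r lerDl.
pose D := descent Q Q' t.
have te : 0 < t * e ^+ 2 by rewrite mulr_gt0 ?exprn_gt0.
pose k := Num.bound (hnorm x ^+ 2 / (t * e ^+ 2)).
have gD i : growth_le N c (iter i D (Q (Q x))).
  elim: i => //= i IH; apply: growth_leB => //; apply: growth_leZ.
  by apply: (growth_le_adj nN bQ QQ' NQ c0); exact: growth_le_comm.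
exists (Q x - iter k D (Q x)).
  elim: k => [|k IH]; first by rewrite subrr -(scale0r (Q (Q x))); exact: growth_leZ.
  have -> : Q x - iter k.+1 D (Q x) =
      (Q x - iter k D (Q x)) + t%:C *: Q' (Q (iter k D (Q x))).
    by rewrite iterS [X in _ - X]/D /descent opprB addrA addrAC.
  apply: growth_leD => //; apply: growth_leZ; rewrite (iter_descentC t cQ).
  exact: (growth_le_adj nN bQ QQ' NQ c0).
rewrite opprB addrC subrK -(iter_descentC t cQ).
rewrite le_sqr_hnorm ?(ltW e0) //.
have := iter_descent_energy QQ' cQ Qb (ltW t0) tb k x; rewrite -/D => h.
have /archi_boundP : 0 <= hnorm x ^+ 2 / (t * e ^+ 2).
  by rewrite divr_ge0 ?sqr_ge0 // ltW.
rewrite -/k ltr_pdivrMr // => h2.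
have := sqr_ge0 (hnorm (iter k D x)).
move=> h3; have {}h : k%:R * t * hnorm (Q (iter k D x)) ^+ 2 <= k%:R * t * e ^+ 2.
  by rewrite -!mulrA; lra.
have [k0|k0] := posnP k.
  by move: h2; rewrite k0 mul0r ltNge sqr_ge0.
by move: h; rewrite ler_pM2l // mulr_gt0 // ltr0n.
Qed.

End Growth.

(** * Norms of weighted shifts *)

Section WeightedShifts.
Context {R : realType}.

Lemma hnorm_l2_basis (I : choiceType) (k : I) : hnorm (l2_basis (R := R) k) = 1.
Proof.
rewrite /hnorm l2_normE /=.
suff -> : nsum (fun i => sqmod ((i == k)%:R : R[i])) = 1%:E by rewrite sqrtr1.
have sq0 i : 0 <= sqmod ((i == k)%:R : R[i]) by exact: sqmod_ge0.
apply/eqP; rewrite eq_le; apply/andP; split; last first.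
  apply: le_trans (nsum_term k sq0).
  by rewrite eqxx /sqmod /= expr1n expr0n addr0.
apply: nsum_ub => F; rewrite [leLHS](_ : _ = \sum_(i <- F) (i == k)%:R); last first.
  apply: eq_bigr => i _; rewrite /sqmod.
  by case: (i == k); rewrite /= ?expr1n expr0n ?addr0.
rewrite -natr_sum (_ : (\sum_(i <- F) (i == k))%N = count_mem k F); last first.
  by rewrite -sum1_count [RHS]big_mkcond; apply: eq_bigr => i _ /=; case: (i == k).
by rewrite (count_uniq_mem _ (fset_uniq F)) lern1 leq_b1.
Qed.

Lemma opnorm_shift_le (w : nat -> R) (bw : bounded_weight w) (c : R) :
  (forall n, 0 < w n) -> opnorm (shift bw) <= c <-> forall n, w n <= c.
Proof.
move=> w0; set S := [set hnorm (shift bw x) | x in [set x | hnorm x <= 1]]%classic.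
have S0 : (S !=set0)%classic.
  exists (hnorm (shift bw 0)), 0 => //=.
  by rewrite -(scale0r 0) (hnormZ 0) normr0 mul0r.
have wS n : S (w n).
  exists (l2_basis n); first by rewrite /= hnorm_l2_basis.
  by rewrite shift_basis hnormZ hnorm_l2_basis mulr1 gtr0_norm.
split=> [Sc n|wc].
  apply: le_trans Sc; apply: ub_le_sup (wS n).
  have [L L0 WL] := bounded_op_ge0 (wshift_bounded nat_pred_optK bw).
  exists L => _ [x /= x1 <-]; apply: le_trans (WL x) _.
  by rewrite ler_piMr.
apply: ge_sup => // _ [x /= x1 <-].
have c0 : 0 <= c by apply: le_trans (wc 0%N); rewrite ltW.
apply: (@le_trans _ _ (c * hnorm x)); last by rewrite ler_piMr.
have wc' n : `|w n| <= c by rewrite gtr0_norm.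
rewrite le_sqr_hnorm ?mulr_ge0 ?hnorm_ge0 // exprMn.
have fin (u : l2 R nat) : nsum (fun i => sqmod (u i)) \is a fin_num.
  rewrite ge0_fin_numE ?nsum_ge0 ?l2P // => i; exact: sqmod_ge0.
have f0 (u : l2 R nat) : 0 <= fine (nsum (fun i => sqmod (u i))).
  by rewrite fine_ge0 // nsum_ge0 // => i; exact: sqmod_ge0.
rewrite /hnorm !l2_normE !sqr_sqrtr //.
rewrite -lee_fin EFinM !fineK //; exact: (wshift_nsum nat_pred_optK x wc').
Qed.

End WeightedShifts.

(** * Weighted shifts inside commuting normal operators *)

Section Lattice.
Context {R : realType} {K : hilbertSpace R}.
Variables (N Q : {linear K -> K}) (e : nat -> nat -> K) (a b : nat -> nat -> R).
Hypotheses (nN : normal_op N) (nQ : normal_op Q) (NQ : forall z, N (Q z) = Q (N z)).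
Hypotheses (a0 : forall i j, 0 < a i j) (b0 : forall i j, 0 < b i j).
Hypotheses (e1 : forall i j, hnorm (e i j) = 1).
Hypotheses (Ne : forall i j, N (e i j) = (a i j)%:C *: e i.+1 j).
Hypotheses (Qe : forall i j, Q (e i j) = (b i j)%:C *: e i j.+1).

(** If the weights of a row are at most c, the norms of iterates of its vectors
    are products of n of them; conversely each weight is a ratio |N m| / |m|. *)
Lemma row_growth j (c : R) : 0 <= c ->
  (forall i, a i j <= c) <-> (forall i, growth_le N c (e i j)).
Proof.
move=> c0; split=> [ac i r cr|g i].
  have r0 : 0 <= r by exact: le_trans c0 (ltW cr).
  exists 1 => n; rewrite mul1r; elim: n i => [|n IH] i; first by rewrite /= e1.
  rewrite iterSr Ne -lin_powE linearZ lin_powE hnormZ gtr0_norm // exprS.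
  by rewrite ler_pM ?hnorm_ge0 ?(ltW (a0 i j)) // (le_trans (ac i)) ?(ltW cr).
have := growth_le_hnorm nN c0 (g i).
by rewrite Ne hnormZ !e1 !mulr1 gtr0_norm.
Qed.

Lemma row_bound_shift j (c : R) : 0 <= c ->
  (forall i, a i j.+1 <= c) <-> (forall i, a i j.+2 <= c).
Proof.
move=> c0.
have unscale (t : R) (x : K) : 0 < t -> t^-1%:C *: (t%:C *: x) = x.
  by move=> t0; rewrite scalerA -rmorphM mulVf ?gt_eqF // scale1r.
split=> /(row_growth _ c0) g; apply/(row_growth _ c0) => i.
  rewrite -(unscale _ (e i j.+2) (b0 i j.+1)) -Qe; apply: growth_leZ.
  by apply: growth_le_comm (g i); first case: nQ.
(* Above the bottom row every [e i j.+1] has a predecessor [e i j], which puts it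
   in the range of [Q]. *)
have Qb : e i j.+1 = Q ((b i j)^-1%:C *: e i j) by rewrite linearZ /= Qe unscale.
rewrite Qb; apply: growth_le_cancel => //; rewrite -Qb Qe; exact: growth_leZ.
Qed.

End Lattice.

Lemma opnorm_row_const (R : realType) (K : hilbertSpace R)
    (N Q : {linear K -> K}) (e : nat -> nat -> K) (a b : nat -> nat -> R)
    (ba : forall j, bounded_weight (a^~ j)) :
  normal_op N -> normal_op Q -> (forall z, N (Q z) = Q (N z)) ->
  (forall i j, 0 < a i j) -> (forall i j, 0 < b i j) ->
  (forall i j, hnorm (e i j) = 1) ->
  (forall i j, N (e i j) = (a i j)%:C *: e i.+1 j) ->
  (forall i j, Q (e i j) = (b i j)%:C *: e i j.+1) ->
  forall j, (1 <= j)%N -> opnorm (shift (ba j)) = opnorm (shift (ba 1%N)).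
Proof.
move=> nN nQ NQ a0 b0 e1 Ne Qe [//|j] _; elim: j => // j <-.
have op0 m : 0 <= opnorm (shift (ba m)).
  apply: le_trans (ltW (a0 0%N m)) _.
  exact: (opnorm_shift_le (ba m) _ (a0^~ m)).1 (lexx _) 0%N.
have S c := row_bound_shift nN nQ NQ a0 b0 e1 Ne Qe j (c := c).
apply/eqP; rewrite eq_le; apply/andP; split.
  apply/(opnorm_shift_le _ _ (a0^~ _))/S => //.
  exact/(opnorm_shift_le _ _ (a0^~ _)).
apply/(opnorm_shift_le _ _ (a0^~ _))/S => //.
exact/(opnorm_shift_le _ _ (a0^~ _)).
Qed.

Unset Implicit Arguments.

Theorem theorem2p3 (R : realType) (alpha beta : nat * nat -> R)
    (alpha_bounded : bounded_weight alpha) (beta_bounded : bounded_weight beta)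
    (alpha_gt0 : forall k : nat * nat, 0 < alpha k)
    (beta_gt0 : forall k : nat * nat, 0 < beta k)
    (commuting : forall i j : nat,
       beta (i.+1, j) * alpha (i, j) = alpha (i, j.+1) * beta (i, j))
    (subnormal : subnormal_pair (shift1 alpha_bounded) (shift2 beta_bounded)) :
  (forall j : nat, (1 <= j)%N ->
     opnorm (shift (bounded_row alpha_bounded j)) =
     opnorm (shift (bounded_row alpha_bounded 1))) /\
  (forall i : nat, (1 <= i)%N ->
     opnorm (shift (bounded_col beta_bounded i)) =
     opnorm (shift (bounded_col beta_bounded 1))).
Proof.
have [K [iota [N1 [N2 [isom [nN1 nN2] N12 N1T N2T]]]]] := subnormal.
pose e i j : K := iota (l2_basis (i, j)).
have e1 i j : hnorm (e i j) = 1.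
  by rewrite -(hnorm_l2_basis (R := R) (i, j)) /hnorm /dot_norm isom.
have N1e i j : N1 (e i j) = (alpha (i, j))%:C *: e i.+1 j.
  by rewrite N1T shift1_basis linearZ.
have N2e i j : N2 (e i j) = (beta (i, j))%:C *: e i j.+1.
  by rewrite N2T shift2_basis linearZ.
split.
  by apply: (opnorm_row_const (e := e) (a := fun i j => alpha (i, j))
    (b := fun i j => beta (i, j)) (bounded_row alpha_bounded) nN1 nN2).
by apply: (opnorm_row_const (e := fun i j => e j i) (a := fun i j => beta (j, i))
  (b := fun i j => alpha (j, i)) (bounded_col beta_bounded) nN2 nN1).
Qed.
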